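(* Let $(\Gamma,\mu)$ be a weighted graph satisfying: $(p_0)$: there is $p_0>0$ with $\mu_{x,y}/\mu(x)\ge p_0$ for all adjacent $x\sim y$; $(VD)$: there is $D_V>0$ with $V(x,2R)\le D_V V(x,R)$ for all $x\in\Gamma$, $R>0$; $(H)$: there is $H>1$ such that for all $x\in\Gamma$, $R>0$ and every non-negative function $u$ harmonic in $B(x,2R)$, $\max_{B(x,R)}u\le H\min_{B(x,R)}u$; $(wTC)$: there is $C_0>0$ with $E(x,R)\le C_0E(y,R)$ for all $x\in\Gamma$, $R>0$, $y\in B(x,R)$. Then there is a constant $C>1$ such that for all $x\in\Gamma$ and all real $R\ge1$ $$C^{-1}\rho(x,R,2R)\,v(x,R,2R)\le E(x,2R)\le C\,\rho(x,R,2R)\,v(x,R,2R).$$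
   Context: $\Gamma$ is a countably infinite connected graph ($x\sim y$ denotes adjacency) with weights $\mu_{x,y}=\mu_{y,x}>0$ on its edges ($\mu_{x,y}=0$ if $x\not\sim y$); $\mu(x)=\sum_{y\sim x}\mu_{x,y}$ and $\mu(A)=\sum_{y\in A}\mu(y)$. $X_n$ is the random walk with transition probabilities $P(x,y)=\mu_{x,y}/\mu(x)$; $Pf(x)=\sum_yP(x,y)f(y)$, $\Delta=P-I$, $(f,g)_\mu=\sum_x f(x)g(x)\mu(x)$. $d$ is the shortest-path distance, $B(x,R)=\{y: d(x,y)<R\}$, $V(x,R)=\mu(B(x,R))$, $v(x,r,R)=V(x,R)-V(x,r)$. $T_A=\min\{k\ge 0: X_k\notin A\}$ and $E(x,R)=\mathbb{E}(T_{B(x,R)}\mid X_0=x)$. For $A\subset\Gamma$, $\overline{A}$ is $A$ together with all vertices adjacent to a vertex of $A$; a function $h$ is harmonic on $A$ if it is defined on $\overline{A}$ and $Ph(x)=h(x)$ for all $x\in A$ (non-negativity is required on $\overline A$). The resistance between disjoint sets $A,B$ is $\rho(A,B)=\left(\inf\{(-\Delta f,f)_\mu: f|_A=1,\ f|_B=0\}\right)^{-1}$, where $(-\Delta f,f)_\mu=\frac12\sum_{x,y}\mu_{x,y}(f(x)-f(y))^2$; and $\rho(x,r,R)=\rho(B(x,r),\Gamma\setminus B(x,R))$. *)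

(* Defs.v *)
From HB Require Import structures.
From mathcomp Require Import all_boot all_order all_algebra.
From mathcomp Require Import all_classical all_reals all_analysis.

Set Implicit Arguments.
Unset Strict Implicit.
Unset Printing Implicit Defensive.

Import Order.TTheory GRing.Theory Num.Theory.
Local Open Scope classical_set_scope.
Local Open Scope ring_scope.

Definition path_of_length (V : eqType) (e : rel V) (x y : V) (n : nat) : Prop :=
  exists p : seq V, [/\ path e x p, last x p = y & size p = n].

(* Loops are allowed. Local finiteness only makes the weight sums below finite
   sums: together with a finite mu x, the lower bound cond_p0 on transition
   probabilities bounds every degree by p0^-1. *)
Record weightedGraph (R : realType) := WeightedGraph {
  vertex :> countType;
  adj : rel vertex;
  weight : vertex -> vertex -> R;
  adj_sym : symmetric adj;
  weight_sym : forall x y, weight x y = weight y x;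
  weight_gt0 : forall x y, adj x y -> 0 < weight x y;
  weight_eq0 : forall x y, ~~ adj x y -> weight x y = 0;
  vertex_infinite : infinite_set [set: vertex];
  adj_connected : forall x y, exists n, `[< path_of_length adj x y n >];
  adj_locally_finite : forall x, finite_set [set y | adj x y] }.

Section WeightedGraphTheory.
Context {R : realType} (G : weightedGraph R).
Implicit Types (x y z : G) (A B : set G) (f u : G -> R) (r s : R).

Definition mu x : R := \sum_(y \in [set y | adj x y]) weight x y.

Definition trans x y : R := weight x y / mu x.

Definition trans_op f x : R := \sum_(y \in [set y | adj x y]) trans x y * f y.

Definition dist x y : nat := ex_minn (adj_connected x y).

Definition gball x r : set G := [set y | (dist x y)%:R < r].

Definition vol x r : R := \sum_(y \in gball x r) mu y.

Definition vol_annulus x r s : R := vol x s - vol x r.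

Definition vclosure A : set G :=
  A `|` [set y | exists2 x, A x & adj x y].

(* The values of trans_op u on A only involve the values of u on vclosure A, so
   total functions lose no generality. *)
Definition harmonic_on A u : Prop := forall x, A x -> trans_op u x = u x.

(* ((- Delta) f, f)_mu; the sum of nonnegative terms may be infinite *)
Definition energy f : \bar R :=
  (2^-1%:E * \esum_(p in [set: G * G])
     (weight p.1 p.2 * (f p.1 - f p.2) ^+ 2)%:E)%E.

Definition resistance A B : \bar R :=
  ((ereal_inf [set energy f | f in
      [set f : G -> R |
        (forall x, A x -> f x = 1) /\ (forall x, B x -> f x = 0)]%R])^-1)%E.

Definition rho x r s : \bar R := resistance (gball x r) (~` gball x s).

Definition cond_p0 : Prop :=
  exists p0 : R, 0 < p0 /\ forall x y, adj x y -> p0 <= weight x y / mu x.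

Definition volume_doubling : Prop :=
  exists D : R, 0 < D /\ forall x r, 0 < r -> vol x (2 * r) <= D * vol x r.

(* Balls of positive radius are finite and nonempty, so ereal_sup and ereal_inf
   are a maximum and a minimum. *)
Definition elliptic_harnack : Prop :=
  exists H : R, 1 < H /\ forall x r u, 0 < r ->
    (forall y, vclosure (gball x (2 * r)) y -> 0 <= u y) ->
    harmonic_on (gball x (2 * r)) u ->
    (ereal_sup [set (u y)%:E | y in gball x r] <=
     H%:E * ereal_inf [set (u y)%:E | y in gball x r])%E.

End WeightedGraphTheory.

(* walk_law x is the law of the walk conditioned on starting at x. *)
Record randomWalk (R : realType) (G : weightedGraph R)
    (d : measure_display) (Omega : measurableType d) := RandomWalk {
  walk_law : G -> probability Omega R;
  walk_pos : nat -> Omega -> G;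
  walk_measurable : forall n y, measurable (walk_pos n @^-1` [set y]);
  walk_init : forall x, walk_law x (walk_pos 0%N @^-1` [set x]) = 1%E;
  walk_step : forall x n (w : nat -> G),
    walk_law x [set o | forall k, (k <= n.+1)%N -> walk_pos k o = w k] =
    (walk_law x [set o | forall k, (k <= n)%N -> walk_pos k o = w k] *
     (trans (w n) (w n.+1))%:E)%E }.

Section ExitTime.
Context {R : realType} {G : weightedGraph R}.
Context {d : measure_display} {Omega : measurableType d}.
Variable X : randomWalk G Omega.

(* +oo if the walk never leaves A *)
Definition exit_time (A : set G) (o : Omega) : \bar R :=
  ereal_inf [set (k%:R)%:E | k in [set k : nat | ~ A (walk_pos X k o)]].

Definition mean_exit_time (x : G) (r : R) : \bar R :=
  (\int[walk_law X x]_o exit_time (gball x r) o)%E.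

Definition weak_time_comparison : Prop :=
  exists C0 : R, 0 < C0 /\ forall (x : G) (r : R), 0 < r ->
    forall y : G, gball x r y ->
      (mean_exit_time x r <= C0%:E * mean_exit_time y r)%E.

End ExitTime.

(* Main.v *)
(** Write [B = B(x,R)], [D = B(x,2R)] and let [g] be the Green density of the walk
    killed outside [D], so that [E(x,2R)] is the sum of [g(x,y) mu(y)] over [D].
    The equilibrium potential [h] of [(B, Gamma \ D)] has charge [mu (h - P h)],
    of total mass [1 / rho(x,R,2R)], carried by the inner boundary of [B], a subset
    of a sphere around [x]; and [1 = h(x)] is the integral of [g(x,.)] against this
    charge.  By the Harnack inequality [g(x,.)] is almost constant on spheres, hence
    comparable to [rho] on the inner boundary.  The minimum principle extends
    [g(x,.) >= rho / L] to [B], which with (VD) gives the lower bound.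
    The maximum principle gives [g(x,.) <= L rho] off [B] and
    [g(x,.) - g_B(x,.) <= L rho] on [B], so [E(x,2R) <= E(x,R) + L rho V(x,2R)].
    Finally the integral of [y |-> E_y(T_D)] against the charge is the integral of
    [h], at most [V(x,2R)], while [E_y(T_D) >= E(y,R) >= E(x,R) / C0] on [B] by
    (wTC); hence [E(x,R) <= C0 rho V(x,2R)]. *)

Require Import Defs.
From mathcomp Require Import all_boot all_order all_algebra.
From mathcomp Require Import all_classical all_reals all_analysis.
From mathcomp Require Import finmap ring lra zify measurable_realfun.

Set Implicit Arguments.
Unset Strict Implicit.
Unset Printing Implicit Defensive.

Import Order.TTheory GRing.Theory Num.Theory numFieldNormedType.Exports.
Local Open Scope classical_set_scope.
Local Open Scope ring_scope.

(** * Laplacian, maximum principle and Dirichlet problem *)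

Section Operator.
Context {R : realType} (G : weightedGraph R).
Implicit Types (x y z : G) (u v f : G -> R) (s : seq G) (c r : R).

Lemma weight_ge0 x y : 0 <= weight x y.
Proof.
by have [xy|xy] := boolP (adj x y); [exact/ltW/weight_gt0|rewrite weight_eq0].
Qed.

Definition nbrs x : seq G := enum_fset (fset_set [set y | adj x y]).

Lemma nbrs_uniq x : uniq (nbrs x).
Proof. exact: fset_uniq. Qed.

Lemma mem_nbrs x y : (y \in nbrs x) = adj x y.
Proof.
rewrite /nbrs in_fset_set; last exact: adj_locally_finite.
by apply/idP/idP => [/set_mem|?]; last exact: mem_set.
Qed.

(** This frees sums over neighbours from the neighbour set, so that one list can serve all vertices
    at once. *)
Lemma fsum_adj x f s : uniq s ->
  (forall y, ~~ adj x y -> f y = 0) -> (forall y, y \notin s -> f y = 0) ->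
  \sum_(y \in [set y | adj x y]) f y = \sum_(y <- s) f y.
Proof.
move=> us fadj fs; rewrite (@fsbig_widen _ _ _ _ _ [set: G])//; last first.
  by move=> y [_ /= /negP]; exact: fadj.
rewrite [RHS]fsbig_seq// [RHS](@fsbig_widen _ _ _ _ _ [set: G])//.
by move=> y [_ /= /negP]; exact: fs.
Qed.

Lemma muE x s : uniq s -> {subset nbrs x <= s} ->
  mu x = \sum_(y <- s) weight x y.
Proof.
move=> us xs; apply: fsum_adj => // y; first exact: weight_eq0.
by move=> ys; apply/weight_eq0/(contra _ ys); rewrite -mem_nbrs => /xs.
Qed.

Lemma trans_eq0 x y : ~~ adj x y -> trans x y = 0.
Proof. by move=> xy; rewrite /trans weight_eq0// mul0r. Qed.

Lemma trans_opE u x s : uniq s ->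
    (forall y, adj x y -> y \notin s -> u y = 0) ->
  trans_op u x = \sum_(y <- s) trans x y * u y.
Proof.
move=> us xs; apply: fsum_adj => // y; first by move=> /trans_eq0->; rewrite mul0r.
move=> ys; have [xy|/trans_eq0->] := boolP (adj x y); last by rewrite mul0r.
by rewrite xs// mulr0.
Qed.

Lemma trans_op_nbrs u x : trans_op u x = \sum_(y <- nbrs x) trans x y * u y.
Proof.
by apply: trans_opE; [exact: nbrs_uniq|move=> y xy; rewrite mem_nbrs xy].
Qed.

Lemma exists_notin s : exists y : G, y \notin s.
Proof.
apply: contrapT => /forallNP sG; apply: (@vertex_infinite R G).
apply: (@sub_finite_set _ _ [set` s]); last exact: finite_seq.
by move=> y _ /=; apply/negPn/negP/sG.
Qed.

Lemma exists_nbr x : exists y, adj x y.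
Proof.
have [y] := exists_notin [:: x]; rewrite inE => yx.
have [n /asboolP[[|z p] [/= pth lst _]]] := adj_connected x y.
  by rewrite lst eqxx in yx.
by exists z; case/andP: pth.
Qed.

Lemma mu_gt0 x : 0 < mu x.
Proof.
have [y xy] := exists_nbr x.
rewrite (muE (nbrs_uniq x))// (bigD1_seq y) ?nbrs_uniq ?mem_nbrs//=.
by rewrite ltr_wpDr ?weight_gt0// sumr_ge0// => z _; exact: weight_ge0.
Qed.

Lemma mu_neq0 x : mu x != 0.
Proof. by rewrite gt_eqF ?mu_gt0. Qed.

Lemma trans_ge0 x y : 0 <= trans x y.
Proof. by rewrite divr_ge0 ?weight_ge0 ?ltW ?mu_gt0. Qed.

Lemma trans_gt0 x y : adj x y -> 0 < trans x y.
Proof. by move=> xy; rewrite divr_gt0 ?weight_gt0 ?mu_gt0. Qed.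

Lemma mu_trans x y : mu x * trans x y = weight x y.
Proof. by rewrite mulrC divfK ?mu_neq0. Qed.

Lemma trans_op_cst c x : trans_op (fun=> c) x = c.
Proof.
rewrite trans_op_nbrs -mulr_suml -mulr_suml -(muE (nbrs_uniq x))//.
by rewrite divff ?mu_neq0 ?mul1r.
Qed.

Lemma trans_opB u v x : trans_op (u \- v) x = trans_op u x - trans_op v x.
Proof.
by rewrite !trans_op_nbrs -sumrB; apply: eq_bigr => y _; rewrite -mulrBr.
Qed.

Lemma trans_opD u v x : trans_op (u \+ v) x = trans_op u x + trans_op v x.
Proof.
by rewrite !trans_op_nbrs -big_split; apply: eq_bigr => y _; rewrite /= -mulrDr.
Qed.

Lemma trans_opZ c u x : trans_op (fun y => c * u y) x = c * trans_op u x.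
Proof.
by rewrite !trans_op_nbrs mulr_sumr; apply: eq_bigr => y _; rewrite mulrCA.
Qed.

Lemma trans_op_le u v x : (forall y, adj x y -> u y <= v y) ->
  trans_op u x <= trans_op v x.
Proof.
move=> uv; rewrite !trans_op_nbrs big_seq [leRHS]big_seq.
by apply: ler_sum => y; rewrite mem_nbrs => xy; rewrite ler_wpM2l ?trans_ge0 ?uv.
Qed.

(* [lap u = - Delta u] *)
Definition lap u x := u x - trans_op u x.

Lemma lapB u v x : lap (u \- v) x = lap u x - lap v x.
Proof. by rewrite /lap trans_opB /=; ring. Qed.

Lemma lapD u v x : lap (u \+ v) x = lap u x + lap v x.
Proof. by rewrite /lap trans_opD /=; ring. Qed.

Lemma lapZ c u x : lap (fun y => c * u y) x = c * lap u x.
Proof. by rewrite /lap trans_opZ mulrBr. Qed.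

(** Here [lap u x] is the average of the nonnegative numbers [M - u z] over the neighbours of [x];
    being at most 0, it forces each of them to vanish. *)
Lemma subharmonic_max u x M : lap u x <= 0 -> u x = M ->
  (forall y, adj x y -> u y <= M) -> forall y, adj x y -> u y = M.
Proof.
move=> hx uxM uM y xy.
have /eqP : \sum_(z <- nbrs x) trans x z * (M - u z) = 0.
  apply/le_anti/andP; split; last first.
    rewrite big_seq sumr_ge0// => z; rewrite mem_nbrs => xz.
    by rewrite mulr_ge0 ?trans_ge0// subr_ge0 uM.
  rewrite -(trans_op_nbrs (fun z => M - u z)).
  by rewrite (trans_opB (fun=> M) u) trans_op_cst -uxM.
rewrite big_seq psumr_eq0; last first.
  move=> z; rewrite mem_nbrs => xz.
  by rewrite mulr_ge0 ?trans_ge0// subr_ge0 uM.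
move=> /allP/(_ y); rewrite mem_nbrs => /(_ xy) /implyP/(_ xy).
by rewrite mulf_eq0 gt_eqF ?trans_gt0//= subr_eq0 => /eqP.
Qed.

Lemma seq_argmax u s x0 : x0 \in s ->
  exists2 x, x \in s & forall y, y \in s -> u y <= u x.
Proof.
elim: s x0 => [//|a s IH] b _; case: s IH => [|d s] IH.
  by exists a; rewrite ?mem_head// => y; rewrite inE => /eqP->.
have [x xs xM] := IH d (mem_head _ _).
have [ax|xa] := leP (u a) (u x).
  exists x; first by rewrite inE xs orbT.
  by move=> y; rewrite inE => /orP[/eqP->//|/xM].
exists a; first exact: mem_head.
by move=> y; rewrite inE => /orP[/eqP->//|/xM/le_trans->//]; exact: ltW.
Qed.

(** A maximum over [s] above [c] would propagate along any path that starts at a maximiser, which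
    would then never leave [s]; but the graph is infinite and connected, so some path does leave. *)
Lemma max_principle s u c :
  (forall x, x \in s -> lap u x <= 0) ->
  (forall x y, x \in s -> adj x y -> y \notin s -> u y <= c) ->
  forall x, x \in s -> u x <= c.
Proof.
move=> us uc x0 x0s; rewrite leNgt; apply/negP => cx0.
have [x xs xmax] : exists2 x, x \in s & forall y, y \in s -> u y <= u x.
  exact: seq_argmax x0s.
have cx : c < u x by apply: lt_le_trans (xmax _ x0s).
have [y ys] := exists_notin s.
have [n /asboolP[p [pth lst _]]] := adj_connected x y.
suff : last x p \in s by rewrite lst (negPf ys).
(* The maximum gets a name of its own, so that it stays fixed while the induction moves [x] along
   the path. *)
have [M uxM] : exists M, u x = M by exists (u x).
rewrite uxM in xmax cx; move: {lst x0s cx0} uxM xs pth.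
elim: p x => [//|z p IH] x uxM xs /= /andP[xz pz].
have leM w : adj x w -> u w <= M.
  move=> xw; have [/xmax//|ws] := boolP (w \in s).
  exact: le_trans (uc _ _ xs xw ws) (ltW cx).
have uz := subharmonic_max (us _ xs) uxM leM xz.
have zs : z \in s.
  apply/negPn/negP => zs; have := uc _ _ xs xz zs.
  by rewrite uz leNgt cx.
exact: IH.
Qed.

Lemma min_principle s u c :
  (forall x, x \in s -> 0 <= lap u x) ->
  (forall x y, x \in s -> adj x y -> y \notin s -> c <= u y) ->
  forall x, x \in s -> c <= u x.
Proof.
move=> us uc x xs; rewrite -lerN2; pose w y := -1 * u y.
have -> : - u x = w x by rewrite /w mulN1r.
apply: (@max_principle s w) => // [y ys|y z ys yz zs].
  by rewrite lapZ mulN1r oppr_le0 us.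
by rewrite /w mulN1r lerN2; apply: uc yz zs.
Qed.

(** This is a square linear system; the maximum and minimum principles give uniqueness, hence
    existence. *)
Lemma dirichlet s (phi : G -> R) : uniq s -> exists u,
  (forall x, x \notin s -> u x = 0) /\ (forall x, x \in s -> lap u x = phi x).
Proof.
case: s => [|x0 t] us; first by exists (fun=> 0).
set s := x0 :: t in us *; set n := size s.
pose ext (w : 'cV[R]_n) y : R :=
  if insub (index y s) is Some i then w i 0 else 0.
have ext0 w y : y \notin s -> ext w y = 0.
  by rewrite -index_mem /ext => ?; rewrite insubN.
have ext_nth w (i : 'I_n) : ext w (nth x0 s i) = w i 0.
  by rewrite /ext index_uniq//; case: insubP => [j _ /val_inj->|/negP[]].
pose A : 'M[R]_n :=
  \matrix_(i, j) ((i == j)%:R - trans (nth x0 s i) (nth x0 s j)).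
have AE w i : (A *m w) i 0 = lap (ext w) (nth x0 s i).
  rewrite mxE /lap (trans_opE us) => [|y _]; last exact: ext0.
  rewrite (big_nth x0) big_mkord -/n.
  under eq_bigr do rewrite mxE mulrBl.
  rewrite sumrB (bigD1 i)//= eqxx mul1r big1 => [|j]; last first.
    by rewrite eq_sym => /negPf->; rewrite mul0r.
  rewrite addr0 ext_nth; congr (_ - _).
  by apply: eq_bigr => j _; rewrite ext_nth.
have Aunit : A \in unitmx.
  (* Since [kermx] is a left kernel, the transpose is taken: a row of the kernel becomes a column
     killed by [A], whose extension by zero is harmonic on [s]. *)
  rewrite -unitmx_tr -row_free_unit -kermx_eq0; apply/eqP/row_matrixP => k.
  set v := row k _; rewrite row0.
  have vA : A *m v^T = 0.
    apply: trmx_inj; rewrite trmx_mul trmxK trmx0.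
    by rewrite /v -row_mul mulmx_ker row0.
  have lap0 y : y \in s -> lap (ext v^T) y = 0.
    move=> ys; rewrite -(nth_index x0 ys).
    have iy : (index y s < n)%N by rewrite index_mem.
    by rewrite -(AE v^T (Ordinal iy)) vA mxE.
  apply/rowP => i; rewrite [RHS]mxE.
  have -> : v 0 i = v^T i 0 by rewrite [RHS]mxE.
  have sin : nth x0 s i \in s by rewrite mem_nth.
  rewrite -ext_nth; apply/le_anti/andP; split.
    apply: (@max_principle s) => // [y /lap0->//|y z _ _ /ext0->//].
  by apply: (@min_principle s) => // [y /lap0->//|y z _ _ /ext0->//].
exists (ext (invmx A *m \col_i phi (nth x0 s i))); split; first exact: ext0.
move=> y ys; have iy : (index y s < n)%N by rewrite index_mem.
rewrite -(nth_index x0 ys) -(AE _ (Ordinal iy)) mulmxA mulmxV// mul1mx mxE.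
by [].
Qed.

(** The operator P is self-adjoint for [mu], because [mu x * trans x y] is the symmetric
    [weight x y]. *)
Lemma green_identity s u v : uniq s ->
  (forall x, x \notin s -> u x = 0) -> (forall x, x \notin s -> v x = 0) ->
  \sum_(x <- s) mu x * (lap u x * v x) = \sum_(x <- s) mu x * (u x * lap v x).
Proof.
move=> us u0 v0; rewrite /lap.
under eq_bigr => x _ do rewrite mulrBl mulrBr.
under [RHS]eq_bigr => x _ do rewrite mulrBr mulrBr.
rewrite !sumrB; congr (_ - _).
have E f g : (forall x, x \notin s -> f x = 0) ->
    \sum_(x <- s) mu x * (trans_op f x * g x) =
    \sum_(x <- s) \sum_(y <- s) weight x y * f y * g x.
  move=> f0; apply: eq_bigr => x _; rewrite (trans_opE us) => [|y _ /f0//].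
  rewrite mulrA mulr_sumr mulr_suml; apply: eq_bigr => y _.
  by rewrite mulrA mu_trans.
rewrite (E u v)//; under [RHS]eq_bigr do rewrite [u _ * _]mulrC.
rewrite (E v u)// exchange_big; apply: eq_bigr => x _; apply: eq_bigr => y _.
by rewrite weight_sym mulrAC.
Qed.

End Operator.

(** * Distance and volume *)

Section Distance.
Context {R : realType} (G : weightedGraph R).
Implicit Types (x y z : G) (u v f : G -> R) (s : seq G) (c r : R).

Lemma dist_path x y :
  exists p, [/\ path (@adj R G) x p, last x p = y & size p = dist x y].
Proof. by rewrite /dist; case: ex_minnP => n /asboolP. Qed.

Lemma dist_le x p : path (@adj R G) x p -> (dist x (last x p) <= size p)%N.
Proof.
move=> xp; rewrite /dist; case: ex_minnP => n _; apply.
by apply/asboolP; exists p.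
Qed.

Lemma distxx x : dist x x = 0%N.
Proof. by apply/eqP; rewrite -leqn0; apply: (@dist_le x [::]). Qed.

Lemma dist_eq0 x y : dist x y = 0%N -> x = y.
Proof.
by have [p [_ <- <-]] := dist_path x y => /eqP; rewrite size_eq0 => /eqP->.
Qed.

Lemma dist_triangle x y z : (dist x z <= dist x y + dist y z)%N.
Proof.
have [p [xp <- <-]] := dist_path x y; have [q [yq <- <-]] := dist_path (last x p) z.
by rewrite -last_cat -size_cat dist_le// cat_path xp.
Qed.

Lemma dist_adj x y : adj x y -> (dist x y <= 1)%N.
Proof. by move=> xy; apply: (@dist_le x [:: y]); rewrite /= xy. Qed.

Lemma dist_sym x y : dist x y = dist y x.
Proof.
suff H (a b : G) : (dist a b <= dist b a)%N by apply/anti_leq; rewrite !H.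
have [p [bp <- <-]] := dist_path b a.
elim: p b bp => [|c p IH] b /=; first by rewrite distxx.
move=> /andP[bc cp]; apply: leq_trans (dist_triangle _ c _) _.
by rewrite -addn1 leq_add ?IH// dist_adj// adj_sym.
Qed.

Lemma dist_le1 x y : (dist x y <= 1)%N -> x = y \/ adj x y.
Proof.
have [[|z [|w p]] [/= xp <- <-]] := dist_path x y => // _; first by left.
by right; case/andP: xp.
Qed.

(** A shortest path is cut after [k] steps; the triangle inequality turns the bounds on both pieces
    into equalities. *)
Lemma dist_between x y k : (k <= dist x y)%N ->
  exists2 z, dist x z = k & dist z y = (dist x y - k)%N.
Proof.
have [p [xp lp sp]] := dist_path x y => kd; rewrite -sp in kd *.
have := xp; rewrite -{1}(cat_take_drop k p) cat_path => /andP[xt td].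
have := dist_le xt; have := dist_le td.
rewrite -last_cat cat_take_drop lp size_drop size_takel//.
set z := last x _ => zy xz; exists z; have := dist_triangle x z y; lia.
Qed.

Lemma finite_dist_le x n : finite_set [set y | (dist x y <= n)%N].
Proof.
elim: n => [|n IH].
  apply: (@sub_finite_set _ _ [set x]); last exact: finite_set1.
  by move=> y /=; rewrite leqn0 => /eqP/dist_eq0.
pose S := [set y | (dist x y <= n)%N].
apply: (@sub_finite_set _ _
  (S `|` \bigcup_(z in S) [set y | adj z y])); last first.
  rewrite finite_setU; split=> //.
  by apply: bigcup_finite => // z _; exact: adj_locally_finite.
move=> y /=; rewrite leq_eqVlt => /orP[/eqP d|]; last by left.
have [|z xz zy] := @dist_between x y n; first by rewrite d.
right; exists z; rewrite /S /= ?xz//.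
by have [|zy'|//] := @dist_le1 z y; [|move: zy; rewrite zy' distxx]; lia.
Qed.

Lemma finite_gball x r : finite_set (gball x r).
Proof.
apply: sub_finite_set (finite_dist_le x (Num.bound r)) => y /= yr.
have r0 : 0 <= r by apply: le_trans (ltW yr).
by rewrite -(ler_nat R) ltW// (lt_trans yr)// archi_boundP.
Qed.

Definition vball x r : seq G := enum_fset (fset_set (gball x r)).

Lemma vball_uniq x r : uniq (vball x r).
Proof. exact: fset_uniq. Qed.

Lemma mem_vball x r y : (y \in vball x r) = ((dist x y)%:R < r).
Proof.
rewrite /vball in_fset_set; last exact: finite_gball.
by apply/idP/idP => [/set_mem|?]; last exact: mem_set.
Qed.

(** Balls are finite and the graph is not, so some vertex lies at distance at least [n], and a
    geodesic towards it crosses the sphere. *)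
Lemma exists_dist x n : exists y, dist x y = n.
Proof.
have [z] := exists_notin (vball x n%:R).
rewrite mem_vball -leNgt ler_nat => nz.
by have [y <- _] := dist_between nz; exists y.
Qed.

Lemma volE x r : vol x r = \sum_(y <- vball x r) mu y.
Proof. by rewrite /vol fsbig_finite//; exact: finite_gball. Qed.

Lemma sum_widen s t f : uniq s -> uniq t -> {subset s <= t} ->
  (forall y, y \in t -> y \notin s -> f y = 0) ->
  \sum_(y <- s) f y = \sum_(y <- t) f y.
Proof.
move=> us ut st f0; rewrite [RHS](bigID (mem s))/= [X in _ + X]big1_seq ?addr0.
  rewrite -[RHS]big_filter; apply/perm_big/uniq_perm => //.
    exact: filter_uniq.
  by move=> y; rewrite mem_filter; case ys: (y \in s) => //=; rewrite st.
by move=> y /andP[ys yt]; exact: f0.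
Qed.

Lemma sum_subset s t f : uniq s -> uniq t -> {subset s <= t} ->
  (forall y, y \in t -> y \notin s -> 0 <= f y) ->
  \sum_(y <- s) f y <= \sum_(y <- t) f y.
Proof.
move=> us ut st f0; rewrite [leRHS](bigID (mem s))/=.
have -> : \sum_(i <- t | i \in s) f i = \sum_(y <- s) f y.
  rewrite -big_filter; apply/perm_big/uniq_perm => //; first exact: filter_uniq.
  move=> y; rewrite mem_filter; case ys: (y \in s) => //=.
  exact: st.
by rewrite lerDl big_seq_cond sumr_ge0// => y /andP[]; exact: f0.
Qed.

Lemma vol_le x r y (r' : R) :
  {subset vball x r <= vball y r'} -> vol x r <= vol y r'.
Proof.
move=> rs; rewrite !volE sum_subset ?vball_uniq// => z _ _.
exact/ltW/mu_gt0.
Qed.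

Lemma vol_gt0 x r : 0 < r -> 0 < vol x r.
Proof.
move=> r0; apply: (@lt_le_trans _ _ (mu x)); first exact: mu_gt0.
rewrite volE -[leLHS](big_seq1 +%R x (@mu R G)) sum_subset ?vball_uniq// => [y|y _ _].
  by rewrite inE => /eqP->; rewrite mem_vball distxx.
exact/ltW/mu_gt0.
Qed.

Lemma vol_annulus_ge x r (s : R) y (t : R) : r <= s -> 
  {subset vball y t <= vball x s} -> (forall z, z \in vball y t -> z \notin vball x r) ->
  vol y t <= vol_annulus x r s.
Proof.
move=> rs ts tr; rewrite /vol_annulus lerBrDr !volE -big_cat /=.
apply: sum_subset => [||z|z _ _]; rewrite ?vball_uniq//.
- rewrite cat_uniq !vball_uniq/= andbT; apply/hasPn => z zr.
  by apply/negP => /tr; rewrite zr.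
- by rewrite mem_cat => /orP[/ts//|]; rewrite !mem_vball => /lt_le_trans->.
- exact/ltW/mu_gt0.
Qed.

(** The annulus contains a ball of some radius [t] whose enlargement by 16 covers the ball of radius
    [2 * r]; four doublings compare the volumes. *)
Lemma vol_annulus_compare x r (D : R) : 0 < D ->
  (forall y (s : R), 0 < s -> vol y (2 * s) <= D * vol y s) -> 1 <= r ->
  vol x (2 * r) <= D ^+ 4 * vol_annulus x r (2 * r).
Proof.
move=> D0 VD r1.
have VD4 y (s : R) : 0 < s -> vol y (16 * s) <= D ^+ 4 * vol y s.
  move=> s0; have VDs c t : 0 < c -> vol y (c * s) <= t * vol y s ->
      vol y (2 * c * s) <= D * t * vol y s.
    move=> c0 cs; rewrite -mulrA (le_trans (VD _ _ _)) ?mulr_gt0//.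
    by rewrite -mulrA ler_pM2l.
  have -> : 16 = 2 * (2 * (2 * (2 * 1))) :> R by lra.
  rewrite !exprS expr0.
  by do 4!(apply: (VDs _ _); first lra); rewrite !mul1r.
suff [y [t [t0 ryt yt]]] : exists y (t : R), [/\ 0 < t,
    forall z, (dist y z)%:R < t -> r <= (dist x z)%:R < 2 * r &
    (dist x y)%:R + 2 * r <= 16 * t].
  rewrite (@le_trans _ _ (vol y (16 * t)))//.
    apply: vol_le => z; rewrite !mem_vball.
    have : ((dist y z)%:R <= (dist x y)%:R + (dist x z)%:R :> R).
      by rewrite -natrD ler_nat (dist_sym x y) dist_triangle.
    lra.
  rewrite (le_trans (VD4 _ _ t0))// ler_pM2l ?exprn_gt0// vol_annulus_ge//.
  - lra.
  - by move=> z; rewrite !mem_vball => /ryt/andP[].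
  - by move=> z; rewrite !mem_vball => /ryt/andP[]; rewrite -leNgt.
(* For small [r] the ball is a single vertex, on a sphere of integer radius between [r] and
   [2 * r]. *)
have [r2|r2] := ltP r 2.
  have [k rk kr] : exists2 k, r <= k%:R & k%:R < 2 * r.
    by have [r1'|r1'] := leP r 1; [exists 1%N|exists 2%N]; lra.
  have [y xy] := exists_dist x k.
  exists y, 1; split=> // [z|]; rewrite ?xy; last lra.
  by rewrite -[1]/(1%:R) ltr_nat ltnS leqn0 => /eqP/dist_eq0 <-; rewrite xy rk.
(* The centre lies at a distance in the interval from 5r/4 to 5r/4 + 1; with radius r/4 the ball
   stays in the annulus, as 3r/2 + 1 is at most 2r. *)
have r0 : 0 <= 5 / 4 * r by lra.
have /andP[k1 k2] := truncn_itv r0; set k := Num.truncn _ in k1 k2.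
have k3 : k.+1%:R <= 5 / 4 * r + 1 by rewrite -natr1 lerD2r.
have [y xy] := exists_dist x k.+1.
exists y, (r / 4); rewrite xy; split=> [|z yz|]; [lra| |lra].
have h1 : ((dist x y)%:R <= (dist y z)%:R + (dist x z)%:R :> R).
  by rewrite -natrD ler_nat addnC (dist_sym y z) dist_triangle.
have h2 : ((dist x z)%:R <= (dist x y)%:R + (dist y z)%:R :> R).
  by rewrite -natrD ler_nat dist_triangle.
by rewrite xy in h1 h2; lra.
Qed.

End Distance.

(** * Green functions and resistance *)

Section Potential.
Context {R : realType} (G : weightedGraph R).
Implicit Types (x y z : G) (u v f phi : G -> R) (s t b : seq G) (c r : R).

(** Using [undup] makes this a function of an arbitrary list, without a proof of [uniq s] as
    argument. *)
Definition dsol s phi : G -> R :=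
  projT1 (cid (@dirichlet R G (undup s) phi (undup_uniq s))).

Lemma dsol_out s phi x : x \notin s -> dsol s phi x = 0.
Proof.
rewrite -mem_undup /dsol => xs; case: cid => u [u0 _] /=; exact: u0.
Qed.

Lemma lap_dsol s phi x : x \in s -> lap (dsol s phi) x = phi x.
Proof.
rewrite -mem_undup /dsol => xs; case: cid => u [_ us] /=; exact: us.
Qed.

Lemma dsol_ge0 s phi x : (forall y, y \in s -> 0 <= phi y) -> 0 <= dsol s phi x.
Proof.
move=> phi0; have [xs|xs] := boolP (x \in s); last by rewrite dsol_out.
apply: (@min_principle _ _ s) => // [y ys|y z _ _ /dsol_out->//].
by rewrite lap_dsol// phi0.
Qed.

Lemma dsol_pair s phi u : uniq s -> (forall x, x \notin s -> u x = 0) ->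
  \sum_(x <- s) mu x * (dsol s phi x * lap u x) =
  \sum_(x <- s) mu x * (phi x * u x).
Proof.
move=> us u0; rewrite -green_identity//; last by move=> x; exact: dsol_out.
rewrite big_seq [RHS]big_seq; apply: eq_bigr => x xs.
by rewrite lap_dsol.
Qed.

(** Dividing by [mu x] gives the density with respect to [mu] of the Green kernel of the walk killed
    outside [s], which is symmetric. *)
Definition green s x := dsol s (fun z => (z == x)%:R / mu x).

(** The mean exit time from [s] as a Dirichlet solution; [mean_exit_timeE] links it to the walk. *)
Definition exit_mean s := dsol s (fun=> 1).

Lemma green_out s x y : y \notin s -> green s x y = 0.
Proof. exact: dsol_out. Qed.

Lemma lap_green s x y : y \in s -> lap (green s x) y = (y == x)%:R / mu x.
Proof. exact: lap_dsol. Qed.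

Lemma lap_green_neq s x y : y \in s -> y != x -> lap (green s x) y = 0.
Proof. by move=> ys /negPf yx; rewrite lap_green// yx mul0r. Qed.

Lemma lap_green_ge0 s x y : y \in s -> 0 <= lap (green s x) y.
Proof. by move=> ys; rewrite lap_green// divr_ge0// ltW// mu_gt0. Qed.

Lemma green_ge0 s x y : 0 <= green s x y.
Proof. by apply: dsol_ge0 => z _; rewrite divr_ge0// ltW// mu_gt0. Qed.

Lemma green_pair s x u : uniq s -> x \in s -> (forall y, y \notin s -> u y = 0) ->
  \sum_(y <- s) mu y * (green s x y * lap u y) = u x.
Proof.
move=> us xs u0; rewrite dsol_pair// (bigD1_seq x)//= big1 => [|y /negPf->].
  by rewrite eqxx addr0 mul1r mulVKf// mu_neq0.
by rewrite !mul0r mulr0.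
Qed.

Lemma green_sym s x y : uniq s -> x \in s -> y \in s ->
  green s x y = green s y x.
Proof.
move=> us xs ys; rewrite -(green_pair us xs (@green_out s y)).
rewrite (bigD1_seq y)//= big1_seq => [|z /andP[zy zs]].
  by rewrite lap_green// eqxx addr0 mulrCA mul1r mulfV ?mu_neq0// mulr1.
by rewrite lap_green_neq// !mulr0.
Qed.

Lemma exit_mean_green s x : uniq s -> x \in s ->
  \sum_(y <- s) mu y * green s x y = exit_mean s x.
Proof.
move=> us xs; rewrite -(@green_pair s x (exit_mean s) us xs (@dsol_out s _)).
rewrite big_seq [RHS]big_seq; apply: eq_bigr => y ys.
by rewrite lap_dsol// mulr1.
Qed.

Lemma exit_mean_ge0 s x : 0 <= exit_mean s x.
Proof. exact: dsol_ge0. Qed.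

Lemma exit_mean_le s t x : {subset s <= t} -> exit_mean s x <= exit_mean t x.
Proof.
move=> st; have [xs|xs] := boolP (x \in s); last first.
  by rewrite [leLHS]dsol_out// exit_mean_ge0.
rewrite -subr_ge0; pose u := exit_mean t \- exit_mean s.
apply: (@min_principle _ _ s u 0) xs => [y ys|y z _ _ zs].
  by rewrite lapB !lap_dsol ?subrr// st.
by rewrite /u /= [exit_mean s z]dsol_out// subr0 exit_mean_ge0.
Qed.

(** In [green t x - green s x] the poles cancel, so this difference is harmonic on [s] and its bound
    [c] off [s] extends to [s]. Summation against [mu] gives the claim. *)
Lemma exit_mean_split s t x c : {subset s <= t} -> uniq s -> uniq t ->
  x \in s -> 0 <= c -> (forall y, y \in t -> y \notin s -> green t x y <= c) ->
  exit_mean t x <= exit_mean s x + c * \sum_(y <- t) mu y.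
Proof.
move=> st us ut xs c0 gc; rewrite -(exit_mean_green us)// -exit_mean_green ?st//.
have -> : \sum_(y <- s) mu y * green s x y = \sum_(y <- t) mu y * green s x y.
  by apply: sum_widen => // y _ ys; rewrite green_out ?mulr0.
rewrite mulr_sumr -big_split/= big_seq [leRHS]big_seq ler_sum// => y yt.
rewrite [c * _]mulrC -mulrDr ler_pM2l ?mu_gt0// -lerBlDl.
have out z : z \notin s -> green t x z - green s x z <= c.
  move=> zs; rewrite [green s x z]green_out// subr0.
  by have [/gc|/green_out->//] := boolP (z \in t); exact.
have [ys|/out//] := boolP (y \in s).
apply: (@max_principle _ _ s (green t x \- green s x)) ys => [z zs|z w _ _].
  by rewrite lapB !lap_green ?subrr// st.
exact: out.
Qed.

(** * Equilibrium potentials and capacity *)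

Definition ind b x : R := (x \in b)%:R.

(** The indicator of [b] is corrected only on [s] minus [b], so as to become harmonic there with its
    values elsewhere unchanged. *)
Definition equil b s :=
  ind b \+ dsol [seq x <- s | x \notin b] (fun x => - lap (ind b) x).

Definition equil_charge b s x := mu x * lap (equil b s) x.

Definition cap b s := \sum_(x <- b) equil_charge b s x.

Section Equilibrium.
Variables (b s : seq G).
Hypothesis bs : {subset b <= s}.
Let h := equil b s.

Lemma equil_in x : x \in b -> h x = 1.
Proof.
by move=> xb; rewrite /h /equil /= /ind xb dsol_out ?addr0// mem_filter xb.
Qed.

Lemma equil_out x : x \notin s -> h x = 0.
Proof.
move=> xs; rewrite /h /equil /= /ind dsol_out ?mem_filter ?(negPf xs) ?andbF//.
by rewrite (contraNF (@bs x) xs) addr0.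
Qed.

Lemma lap_equil x : x \in s -> x \notin b -> lap h x = 0.
Proof.
by move=> xs xb; rewrite /h /equil lapD lap_dsol ?subrr// mem_filter xb.
Qed.

Lemma equil_le1 x : h x <= 1.
Proof.
have [xb|xb] := boolP (x \in b); first by rewrite equil_in.
have [xs|xs] := boolP (x \in s); last by rewrite equil_out.
apply: (@max_principle _ _ [seq x <- s | x \notin b]) => [y|y z _ _|].
- by rewrite mem_filter => /andP[yb ys]; rewrite lap_equil.
- rewrite mem_filter negb_and negbK => /orP[/equil_in->//|/equil_out->//].
- by rewrite mem_filter xb.
Qed.

Lemma equil_charge_ge0 x : x \in b -> 0 <= equil_charge b s x.
Proof.
move=> xb; rewrite mulr_ge0 ?(ltW (mu_gt0 _))// subr_ge0 -/h equil_in//.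
by rewrite -[leRHS](trans_op_cst 1 x) trans_op_le// => y _; exact: equil_le1.
Qed.

Lemma equil_charge_eq0 x : x \in b -> (forall y, adj x y -> y \in b) ->
  equil_charge b s x = 0.
Proof.
move=> xb nb; rewrite /equil_charge /lap -/h equil_in// -[X in X - _](trans_op_cst 1 x).
have -> : trans_op h x = trans_op (fun=> 1) x.
  by apply/le_anti/andP; split; apply: trans_op_le => y /nb/equil_in->.
by rewrite subrr mulr0.
Qed.

Hypotheses (ub : uniq b) (us : uniq s).

Lemma sum_charge u : \sum_(x <- s) mu x * (u x * lap h x) =
  \sum_(x <- b) equil_charge b s x * u x.
Proof.
rewrite -(@sum_widen _ _ b s)// => [|y ys yb]; last by rewrite lap_equil// !mulr0.
by apply: eq_bigr => x _; rewrite /equil_charge -/h mulrCA mulrC mulrAC.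
Qed.

(** Moving the Laplacian from the potential to the Green function evaluates the potential at [x]. *)
Lemma equil_charge_green x : x \in b ->
  \sum_(y <- b) equil_charge b s y * green s x y = 1.
Proof.
move=> xb; rewrite -sum_charge green_pair ?bs ?equil_in//.
exact: equil_out.
Qed.

(** As [exit_mean s] has Laplacian 1 on [s], the left side is the integral of the potential, which
    is at most 1. *)
Lemma equil_charge_exit_mean :
  \sum_(y <- b) equil_charge b s y * exit_mean s y <= \sum_(y <- s) mu y.
Proof.
rewrite -sum_charge dsol_pair//; last exact: equil_out.
by apply: ler_sum => y _; rewrite mul1r ler_piMr ?equil_le1// ltW ?mu_gt0.
Qed.

End Equilibrium.

(** * Dirichlet form and resistance *)

Definition adj_closure s : seq G := undup (s ++ flatten [seq nbrs x | x <- s]).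

Lemma mem_adj_closure s x : x \in s -> x \in adj_closure s.
Proof. by move=> xs; rewrite mem_undup mem_cat xs. Qed.

Lemma nbr_adj_closure s x y : x \in s -> adj x y -> y \in adj_closure s.
Proof.
move=> xs xy; rewrite mem_undup mem_cat; apply/orP; right.
by apply/flattenP; exists (nbrs x); rewrite ?map_f// mem_nbrs.
Qed.

Definition dform t f v : R :=
  2^-1 * \sum_(x <- t) \sum_(y <- t) weight x y * ((f x - f y) * (v x - v y)).

Lemma dformE s f v : uniq s ->
    (forall x, x \notin s -> f x = 0) -> (forall x, x \notin s -> v x = 0) ->
  dform (adj_closure s) f v = \sum_(x <- s) mu x * (f x * lap v x).
Proof.
move=> us f0 v0; rewrite /dform; set t := adj_closure s.
have ut : uniq t by exact: undup_uniq.
(* Exchanging [x] and [y] shows that the two halves of [f x - f y] contribute equally. *)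
pose a x y := weight x y * (f x * (v x - v y)).
have -> : \sum_(x <- t) \sum_(y <- t) weight x y * ((f x - f y) * (v x - v y)) =
    2 * \sum_(x <- t) \sum_(y <- t) a x y.
  transitivity (\sum_(x <- t) \sum_(y <- t) a x y +
                \sum_(x <- t) \sum_(y <- t) a y x); last first.
    by rewrite (exchange_big _ _ _ _ _ (fun x y => a y x)) /=; ring.
  rewrite -big_split; apply: eq_bigr => x _; rewrite -big_split.
  by apply: eq_bigr => y _; rewrite /a /= [weight y x]weight_sym; ring.
rewrite mulKf ?pnatr_eq0// -(@sum_widen _ _ s t)// => [|x|x _ xs]; first last.
- by rewrite big1// => y _; rewrite /a f0// mul0r mulr0.
- exact: mem_adj_closure.
rewrite big_seq [RHS]big_seq; apply: eq_bigr => x xs.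
have xt : {subset nbrs x <= t}.
  by move=> y; rewrite mem_nbrs; exact: nbr_adj_closure.
rewrite /a /lap mulrBr mulrBr.
under eq_bigr do rewrite mulrBr mulrBr.
rewrite sumrB -mulr_suml -(muE ut xt); congr (_ - _).
rewrite (trans_opE ut) => [|y xy /negP[]]; last exact: nbr_adj_closure xs xy.
rewrite !mulr_sumr; apply: eq_bigr => y _.
by rewrite -mu_trans; ring.
Qed.

(** An edge that contributes has an endpoint in [s], hence both endpoints in [adj_closure s]. *)
Lemma energyE s f : (forall x, x \notin s -> f x = 0) ->
  energy f = (dform (adj_closure s) f f)%:E.
Proof.
move=> f0; rewrite /energy /dform EFinM; congr (_ * _)%E.
set t := adj_closure s; have ut : uniq t by exact: undup_uniq.
pose F (p : G * G) := weight p.1 p.2 * (f p.1 - f p.2) ^+ 2.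
have F0 p : p \notin [seq (x, y) | x <- t, y <- t] -> F p = 0.
  case: p => x y /negP pt; rewrite /F /=; apply/eqP/negPn/negP.
  rewrite mulf_eq0 negb_or sqrf_eq0 => /andP[w0 fxy]; apply: pt.
  have xy : adj x y by apply: contraNT w0 => /weight_eq0->.
  have [xs|/f0 fx] := boolP (x \in s).
    apply: allpairs_f; first exact: mem_adj_closure.
    exact: nbr_adj_closure xs xy.
  have [ys|/f0 fy] := boolP (y \in s); last by rewrite fx fy subrr eqxx in fxy.
  apply: allpairs_f; last exact: mem_adj_closure.
  by apply: nbr_adj_closure ys _; rewrite adj_sym.
have upt : uniq [seq (x, y) | x <- t, y <- t].
  by apply: allpairs_uniq => // -[x1 y1] [x2 y2].
transitivity (\esum_(p in [set` [seq (x, y) | x <- t, y <- t]]) (F p)%:E)%E.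
  rewrite [RHS]esum_mkcond; apply: eq_esum => p _.
  case: ifPn => //; rewrite notin_setE => /negP/F0 Fp.
  by rewrite -/(F p) Fp.
rewrite esum_fset; first last.
- by move=> p _; rewrite lee_fin mulr_ge0 ?weight_ge0 ?sqr_ge0.
- exact: finite_seq.
by rewrite -fsbig_seq// sumEFin big_allpairs_dep.
Qed.

Lemma dform_le t f v : 2 * dform t f v - dform t v v <= dform t f f.
Proof.
rewrite /dform mulrCA -mulrBr ler_pM2l ?invr_gt0// lerBlDr mulr_sumr -big_split/=.
apply: ler_sum => x _; rewrite mulr_sumr -big_split/=.
apply: ler_sum => y _; rewrite -mulrDr mulrCA ler_wpM2l ?weight_ge0//.
by rewrite -subr_ge0; have := sqr_ge0 ((f x - f y) - (v x - v y)); lra.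
Qed.

(** Dirichlet principle: every admissible [f], the potential included, pairs with the potential to
    [cap b s], so [dform_le] bounds its energy below by [2 * cap b s - cap b s]. *)
Lemma resistanceE b s : {subset b <= s} -> uniq b -> uniq s -> 0 < cap b s ->
  resistance [set` b] (~` [set` s]) = ((cap b s)^-1)%:E.
Proof.
move=> bs ub us c0; rewrite /resistance.
suff -> : ereal_inf [set energy f | f in
    [set f : G -> R | (forall x, [set` b] x -> f x = 1) /\
      (forall x, (~` [set` s]) x -> f x = 0)]%R] = (cap b s)%:E.
  by rewrite inver gt_eqF.
have h0 := equil_out bs.
have hf f : (forall x, x \in b -> f x = 1) -> (forall x, x \notin s -> f x = 0) ->
    dform (adj_closure s) f (equil b s) = cap b s.
  move=> f1 f0; rewrite dformE// sum_charge// /cap big_seq [RHS]big_seq.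
  by apply: eq_bigr => x xb; rewrite f1// mulr1.
apply/le_anti/andP; split.
  apply: ereal_inf_lbound; exists (equil b s); last first.
    by rewrite (energyE h0) hf//; exact: equil_in.
  by split=> [x /equil_in//|x /negP/h0].
apply: le_ereal_inf_tmp => _ [f [f1 f0] <-].
have f0' x : x \notin s -> f x = 0 by move=> /negP; exact: f0.
rewrite (energyE f0') lee_fin.
have := dform_le (adj_closure s) f (equil b s).
by rewrite !hf//; [lra|exact: equil_in].
Qed.

End Potential.

(** * Green functions on spheres *)

Section Harnack.
Context {R : realType} (G : weightedGraph R).
Implicit Types (x y z w p q : G) (u : G -> R) (s : seq G) (m n : nat).

Lemma harmonic_on_lap (A : set G) u :
  (forall y, A y -> lap u y = 0) -> harmonic_on A u.
Proof. by move=> uA y /uA/eqP; rewrite /lap subr_eq0 => /eqP. Qed.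

(* Steps of length [m %/ 16 + 1] are within reach of the Harnack inequality on a
   vball of radius [m / 2], or have length at most 1. *)
Definition harnack_constant (K : R) := forall m p q u, (0 < m)%N ->
  (forall y, 0 <= u y) -> (forall w, (2 * dist p w < m)%N -> lap u w = 0) ->
  (dist p q <= m %/ 16 + 1)%N -> u q <= K * u p.

(** For [m] below 16 the step is at most 1, and harmonicity at [p] with the lower bound [p0]
    suffices; otherwise the Harnack inequality applies. *)
Lemma harnack_constant_exists : cond_p0 G -> elliptic_harnack G ->
  exists2 K, 1 <= K & harnack_constant K.
Proof.
move=> [p0 [p0_gt0 hp0]] [H [H1 hH]].
exists (Num.max H p0^-1); first by rewrite le_max (ltW H1).
move=> m p q u m0 u0 hu dpq.
suff : u q <= H * u p \/ u q <= p0^-1 * u p.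
  by move=> [] /le_trans; apply; rewrite ler_wpM2r// le_max lexx ?orbT.
have [m16|m16] := ltnP m 16.
  right; rewrite (divn_small m16) in dpq.
  have [<-|pq] := dist_le1 dpq.
    rewrite -[leLHS]mul1r ler_wpM2r// invf_ge1//.
    have [y py] := exists_nbr p; rewrite (le_trans (hp0 _ _ py))//.
    rewrite ler_pdivrMr ?mu_gt0// mul1r (muE (nbrs_uniq p))//.
    rewrite (bigD1_seq y) ?nbrs_uniq ?mem_nbrs//= lerDl sumr_ge0// => z _.
    exact: weight_ge0.
  rewrite ler_pdivlMl//; have := hu p; rewrite distxx muln0 => /(_ m0)/eqP.
  rewrite /lap subr_eq0 trans_op_nbrs => /eqP ->.
  rewrite (bigD1_seq q) ?nbrs_uniq ?mem_nbrs//= ler_wpDr ?sumr_ge0//.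
    by move=> z _; rewrite mulr_ge0 ?trans_ge0.
  by rewrite ler_wpM2r// hp0.
(* The doubled radius m/2 matches the region of harmonicity, and a step is at most m/8 since [m] is
   at least 16. *)
left; have m4 : 0 < m%:R / 4 :> R by rewrite divr_gt0 ?ltr0n.
have hq : harmonic_on (gball p (2 * (m%:R / 4))) u.
  apply: harmonic_on_lap => y py; apply: hu; rewrite -(ltr_nat R) natrM.
  by have := py; rewrite /gball /=; lra.
have := hH _ _ _ m4 (fun y _ => u0 y) hq.
rewrite -lee_fin EFinM => le_sup_inf.
apply: (@le_trans _ _ (ereal_sup [set (u y)%:E | y in gball p (m%:R / 4)])).
  apply: ereal_sup_ubound; exists q => //; rewrite /gball /=.
  rewrite ltr_pdivlMr// -natrM ltr_nat; lia.
rewrite (le_trans le_sup_inf)// lee_pmul2l ?lte_fin//; last by rewrite (lt_trans _ H1).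
by apply: ereal_inf_lbound; exists p => //; rewrite /gball /= distxx.
Qed.

Variable K : R.
Hypotheses (K1 : 1 <= K) (hK : harnack_constant K).

(** Harnack steps follow a geodesic from [y] to [z]. Any vertex between an intermediate vertex and
    [z] is also between [y] and [z], so the hypothesis survives the induction. *)
Lemma harnack_chain m n y z u : (0 < m)%N -> (forall w, 0 <= u w) ->
  (forall p w, (dist y p + dist p z = dist y z)%N -> (2 * dist p w < m)%N ->
     lap u w = 0) ->
  (dist y z <= n * (m %/ 16 + 1))%N -> u z <= K ^+ n * u y.
Proof.
move=> m0 u0; elim: n y => [|n IH] y hu dyz.
  have /dist_eq0-> : dist y z = 0%N by lia.
  by rewrite expr0 mul1r.
set t := (m %/ 16 + 1)%N in dyz.
have [|y' yy' y'z] := @dist_between _ _ y z (minn (dist y z) t); first lia.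
rewrite exprSr -mulrA; apply: (@le_trans _ _ (K ^+ n * u y')).
  apply: IH; last by rewrite y'z -/t; lia.
  move=> p w py' pw; apply: (hu p) => //.
  by have := dist_triangle y y' p; have := dist_triangle y p z; lia.
rewrite ler_pM2l ?exprn_gt0//; last by rewrite (lt_le_trans _ K1).
apply: hK m0 u0 _ _ => [w yw|]; last by rewrite yy' /t; lia.
by apply: (hu y) => //; rewrite distxx.
Qed.

(* No connectivity of annuli is needed: if [y] and [z] are far apart, the
   geodesics from [x] to [y] and to [z] stay away from [z] and [y] respectively,
   so [g(x,y)] and [g(x,z)] are both comparable to [g(y,z) = g(z,y)]. *)
Lemma green_sphere s x y z m : uniq s ->
  (forall w, (dist x w < 2 * m)%N -> w \in s) -> dist x y = m -> dist x z = m ->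
  green s x y <= K ^+ 32 * green s x z.
Proof.
move=> us ms xy xz.
have [m0|m0] := posnP m.
  move: xy xz; rewrite m0 => /dist_eq0 <- /dist_eq0 <-.
  by rewrite -[leLHS]mul1r ler_wpM2r ?green_ge0// exprn_ege1.
have m16 : (m <= 16 * (m %/ 16 + 1))%N by lia.
have xs : x \in s by apply: ms; rewrite distxx; lia.
have ys : y \in s by apply: ms; lia.
have zs : z \in s by apply: ms; lia.
(* If [y] and [z] are close, a vertex between them has distance to [x] above m/2 and below 3m/2, so
   its ball of radius m/2 avoids the pole [x] and stays in [s]. *)
have [yz|yz] := ltnP (dist y z) m.
  apply: (@le_trans _ _ (K ^+ 16 * green s x z)); last first.
    by rewrite ler_wpM2r ?green_ge0// ler_weXn2l.
  apply: (@harnack_chain m) => // [w|p w pyz pw|].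
  - exact: green_ge0.
  - have := dist_triangle x p z; have := dist_triangle x p y.
    have := dist_triangle x z p; have := dist_triangle x y p.
    have := dist_triangle x p w.
    rewrite !(dist_sym p y) (dist_sym z p) (dist_sym z y) in pyz *.
    move=> *; apply: lap_green_neq; first by apply: ms; lia.
    by apply/eqP => wx; rewrite wx (dist_sym p x) in pw; lia.
  - by rewrite dist_sym; lia.
(* A vertex between [x] and [b] is within m/2 of [x] or of [b], both at distance at least [m] from
   [a]; hence it is at least m/2 away from the pole [a]. *)
have far a b : dist x a = m -> dist x b = m -> (m <= dist a b)%N ->
    a \in s -> green s a b <= K ^+ 16 * green s a x /\
    green s a x <= K ^+ 16 * green s a b.
  move=> xa xb ab as_.
  have hg p w : (dist x p + dist p b = m)%N -> (2 * dist p w < m)%N ->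
      lap (green s a) w = 0.
    move=> xpb pw; have := dist_triangle x p w; have := dist_triangle a p b.
    have := dist_triangle x p a; rewrite (dist_sym p a) => *.
    apply: lap_green_neq; first by apply: ms; lia.
    by apply/eqP => wa; rewrite wa (dist_sym p a) in pw; lia.
  split; apply: (@harnack_chain m) => // [w|p w|]; rewrite ?green_ge0//.
  - by rewrite xb; exact: hg.
  - by rewrite xb; lia.
  - by rewrite (dist_sym b p) (dist_sym p x) (dist_sym b x) xb addnC; exact: hg.
  - by rewrite dist_sym xb; lia.
rewrite (green_sym us xs ys) (le_trans (far _ _ xy xz yz ys).2)//.
rewrite -[32%N]/(16 + 16)%N exprD -mulrA ler_wpM2l ?exprn_ge0 ?(le_trans _ K1)//.
rewrite (green_sym us ys zs) (green_sym us xs zs) dist_sym in yz *.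
exact: (far _ _ xz xy yz zs).1.
Qed.

End Harnack.

(** * Mean exit times *)

Section Killed.
Context {R : realType} (G : weightedGraph R).
Implicit Types (x y z : G) (f : G -> R) (s : seq G).

Definition killed_op s f x : R := \sum_(y <- s) trans x y * f y.

(** The probability of being in [s] at times 1 to [n]; time 0 is not tested. *)
Definition survival s n : G -> R := iter n (killed_op s) (fun=> 1).

Lemma killed_op_ge0 s f : (forall x, 0 <= f x) -> forall x, 0 <= killed_op s f x.
Proof. by move=> f0 x; rewrite sumr_ge0// => y _; rewrite mulr_ge0 ?trans_ge0. Qed.

Lemma survival_ge0 s n x : 0 <= survival s n x.
Proof. by elim: n x => [//|n IH] x; exact: killed_op_ge0. Qed.

(** With Q the killed operator, [exit_mean s] equals 1 plus its image under Q on [s], so the partial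
    sums telescope to [exit_mean s x - rest n x]. *)
Lemma survival_series s x : uniq s -> x \in s ->
  (\sum_(n <oo) (survival s n x)%:E = (exit_mean s x)%:E)%E.
Proof.
move=> us xs; pose rest n := iter n (killed_op s) (exit_mean s).
have restS n y : y \in s -> rest n y = survival s n y + rest n.+1 y.
  elim: n y => [|n IH] y ys.
    have := lap_dsol (fun=> 1) ys; rewrite -/(exit_mean s) /lap => /eqP.
    rewrite subr_eq addrC (trans_opE us); first by move/eqP; rewrite addrC.
    by move=> z _; exact: dsol_out.
  rewrite [LHS]/= [X in _ + X]/= [X in X + _]/= /killed_op -big_split/=.
  rewrite big_seq [RHS]big_seq; apply: eq_bigr => z zs.
  by rewrite -mulrDr; congr (_ * _); exact: IH.
have rest0 n y : 0 <= rest n y.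
  by elim: n y => [|n IH] y; [exact: exit_mean_ge0|exact: killed_op_ge0].
(* The constant [c] dominates [exit_mean s], so [rest n] is at most [c] times [survival s n], which
   tends to 0 because its partial sums are bounded. *)
pose c := \sum_(z <- s) exit_mean s z.
have rest_le n y : rest n y <= c * survival s n y.
  elim: n y => [|n IH] y.
    rewrite mulr1 /rest /=; have [ys|ys] := boolP (y \in s).
      rewrite /c (bigD1_seq y)//= lerDl sumr_ge0// => z _.
      exact: exit_mean_ge0.
    by rewrite [leLHS]dsol_out// sumr_ge0// => z _; exact: exit_mean_ge0.
  rewrite /= /killed_op mulr_sumr ler_sum// => z _.
  by rewrite mulrCA ler_wpM2l ?trans_ge0//; exact: IH.
have seriesE n : series (survival s ^~ x) n = exit_mean s x - rest n x.
  elim: n => [|n IH]; first by rewrite /series /= big_nil subrr.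
  by rewrite seriesSr IH (restS n x xs); ring.
have cvg_survival : survival s ^~ x @ \oo --> 0.
  apply: cvg_series_cvg_0; apply: nondecreasing_is_cvgn.
    by apply/nondecreasing_seqP => n; rewrite seriesSr lerDl survival_ge0.
  exists (exit_mean s x) => _ [n _ <-].
  by rewrite seriesE gerBl.
have cvg_rest : rest ^~ x @ \oo --> 0.
  apply: (squeeze_cvgr (f := fun=> 0) (h := fun n => c * survival s n x)).
  - by apply: nearW => n; rewrite rest0 rest_le.
  - exact: cvg_cst.
  - rewrite -[X in _ --> X](mulr0 c).
    exact: (cvgM (cvg_cst c) cvg_survival).
have cvg_sum : series (survival s ^~ x) @ \oo --> exit_mean s x.
  rewrite (_ : series _ = fun n => exit_mean s x - rest n x); last exact/funext.
  rewrite -[X in _ --> X]subr0; apply: cvgB => //; exact: cvg_cst.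
rewrite -(cvg_lim _ cvg_sum)// -EFin_lim; last by apply/cvg_ex; eexists; exact: cvg_sum.
apply: congr_lim; apply/funext => n /=.
by rewrite sumEFin.
Qed.

End Killed.

(** * Exit times of the random walk *)

Section ExitTime.
Context {R : realType} {G : weightedGraph R}.
Context {d : measure_display} {Omega : measurableType d}.
Variable X : randomWalk G Omega.
Implicit Types (s : seq G) (x : G) (w : nat -> G).

Lemma measurable_walk (P : set nat) (B : nat -> set G) :
  measurable [set o | forall k, P k -> B k (walk_pos X k o)].
Proof.
rewrite [X in measurable X](_ : _ =
    \bigcap_(k in P) (walk_pos X k @^-1` B k)); last first.
  by apply/seteqP; split=> o.
apply: bigcap_measurableType => k _.
rewrite [X in measurable X](_ : _ =
    \bigcup_y (if `[< B k y >] then walk_pos X k @^-1` [set y] else set0)).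
  apply: countable_bigcupT_measurable => [|y]; first exact: countableP.
  by case: ifP => // _; exact: walk_measurable.
apply/seteqP; split=> [ o Bo|o [y _]].
  by exists (walk_pos X k o) => //=; case: asboolP.
by case: asboolP => [yB /= ->|].
Qed.

Definition cylinder (n : nat) w : set Omega :=
  [set o | forall k, (k <= n)%N -> walk_pos X k o = w k].

Definition remains s (m n : nat) : set Omega :=
  [set o | forall k, (m < k <= m + n)%N -> walk_pos X k o \in s].

Lemma measurable_cylinder n w : measurable (cylinder n w).
Proof.
exact: (@measurable_walk [set k | (k <= n)%N] (fun k => [set w k])).
Qed.

Lemma measurable_remains s m n : measurable (remains s m n).
Proof.
exact: (@measurable_walk [set k | (m < k <= m + n)%N] (fun k => [set` s])).
Qed.

(** The event is split by the position at time [m.+1]; fixing the whole past in the cylinder lets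
    [walk_step] serve as the Markov property. *)
Lemma cylinder_remains x s n m w : uniq s ->
  walk_law X x (cylinder m w `&` remains s m n) =
  (walk_law X x (cylinder m w) * (survival s n (w m))%:E)%E.
Proof.
move=> us; elim: n m w => [|n IH] m w.
  rewrite mule1; congr (walk_law X x _); apply/seteqP; split=> [ o []//|o wo].
  by split=> // k; lia.
pose w' z k := if k == m.+1 then z else w k.
have -> : cylinder m w `&` remains s m n.+1 =
    \bigcup_(z in [set` s]) (cylinder m.+1 (w' z) `&` remains s m.+1 n).
  apply/seteqP; split=> [ o [wo so]|o [z /= zs [wo so]]].
    exists (walk_pos X m.+1 o); first by apply: so; lia.
    split=> k km; last by apply: so; lia.
    by rewrite /w'; case: eqP => [->//|?]; apply: wo; lia.
  split=> k km.
    by have := wo k; rewrite /w'; case: eqP => [|_]; [lia|apply; lia].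
  have [->|km'] := eqVneq k m.+1; last by apply: so; lia.
  by rewrite wo// /w' eqxx.
rewrite measure_fin_bigcup; first last.
- move=> z _.
  by apply: measurableI; [exact: measurable_cylinder|exact: measurable_remains].
- move=> y z _ _ [ o [[wy _] [wz _]]].
  by have := wy m.+1 (leqnn _); rewrite wz// /w' eqxx.
- exact: finite_seq.
rewrite -fsbig_seq//= /killed_op -sumEFin ge0_sume_distrr; last first.
  by move=> z _; rewrite lee_fin mulr_ge0 ?trans_ge0 ?survival_ge0.
apply: eq_bigr => z _; rewrite IH /cylinder walk_step /w' eqxx.
rewrite (_ : (m == m.+1) = false); last lia.
rewrite [(trans _ _ * survival _ _ _)%:E]EFinM muleA.
congr (_ * _ * _)%E; congr (walk_law X x _).
apply/seteqP; split=> o wo k km; rewrite wo//.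
  by case: eqP => // ?; lia.
by case: eqP => // ?; lia.
Qed.

Lemma walk_law_survival x s n : uniq s -> x \in s ->
  walk_law X x [set o | forall k, (k <= n)%N -> walk_pos X k o \in s] =
  (survival s n x)%:E.
Proof.
move=> us xs; have init : walk_law X x (cylinder 0 (fun=> x)) = 1%E.
  rewrite -(walk_init X x); congr (walk_law X x _).
  apply/seteqP; split=> o /= ox; first exact: ox.
  by move=> k; rewrite leqn0 => /eqP->.
have := @cylinder_remains x s n 0 (fun=> x) us.
rewrite init mul1e => <-; apply/esym.
(* The start is almost surely [x], so intersecting with that cylinder leaves the probability
   unchanged. *)
have mcyl := measurable_cylinder 0 (fun=> x).
set A := [set o | forall k, (k <= n)%N -> walk_pos X k o \in s].
have mA : measurable A.
  exact: (@measurable_walk [set k | (k <= n)%N] (fun k => [set` s])).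
rewrite (@measureDI _ _ _ _ A (cylinder 0 (fun=> x)) mA mcyl).
rewrite (_ : A `&` _ = cylinder 0 (fun=> x) `&` remains s 0 n); last first.
  apply/seteqP; split=> [ o [Ao ox]|o [ox so]].
    by split=> // k /andP[_ kn]; exact: Ao.
  split=> // k kn; have [->|k0] := posnP k; first by rewrite ox.
  by apply: so; rewrite k0 add0n.
rewrite [X in (X + _)%E](_ : _ = 0%E) ?add0e//.
apply/le_anti; rewrite measure_ge0 andbT.
apply: (@le_trans _ _ (walk_law X x (~` cylinder 0 (fun=> x)))).
  apply: le_measure; [exact/mem_set/measurableD|exact/mem_set/measurableC|].
  by move=> o [].
by rewrite probability_setC// init subee.
Qed.

(** The exit time counts the [n] at which the walk has not yet left [A]; this form can be integrated
    term by term. *)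
Lemma exit_timeE (A : set G) o :
  exit_time X A o = (\sum_(n <oo)
    (\1_[set o | forall k, (k <= n)%N -> A (walk_pos X k o)] o)%:E)%E.
Proof.
set F := fun n => [set o | forall k, (k <= n)%N -> A (walk_pos X k o)].
have ind0 n : (0 <= (\1_(F n) o)%:E :> \bar R)%E by rewrite lee_fin.
have ind_sum n : (forall k, (k < n)%N -> F k o) ->
    (\sum_(0 <= i < n) (\1_(F i) o)%:E = n%:R%:E :> \bar R)%E.
  move=> Fo; rewrite sumEFin; congr (_%:E).
  under eq_big_nat => i /andP[_ ni].
    rewrite indicE mem_set; last exact: Fo.
    over.
  by rewrite sumr_const_nat subn0.
have [[k Ak]|/forallNP noexit] := pselect (exists k, ~ A (walk_pos X k o)).
  have exk : exists k, `[< ~ A (walk_pos X k o) >] by exists k; apply/asboolP.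
  case: (ex_minnP exk) => m /asboolP Am mmin.
  have -> : exit_time X A o = m%:R%:E.
    apply/le_anti/andP; split; first by apply: ereal_inf_lbound; exists m.
    apply: le_ereal_inf_tmp => _ [j /= Aj <-].
    by rewrite lee_fin ler_nat mmin//; apply/asboolP.
  rewrite (nneseries_split 0%N m)//= add0n ind_sum.
    rewrite eseries0 ?adde0// => i mi _.
    by rewrite indicE memNset// => /(_ m mi).
  move=> j jm i ij; apply: contrapT => Ai.
  by have := mmin i; rewrite asboolT// => /(_ isT); lia.
rewrite /exit_time (_ : [set k : nat | _] = set0); last first.
  by apply/seteqP; split=> // k /noexit.
rewrite image_set0 ereal_inf0; apply/esym/eqyP => c c0.
apply: (@le_trans _ _ ((Num.bound c)%:R%:E)).
  by rewrite lee_fin ltW// archi_boundP// ltW.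
rewrite -ind_sum; first exact: nneseries_lim_ge.
by move=> j _ i _; apply: contrapT => /noexit.
Qed.

Lemma mean_exit_timeE x (r : R) : 0 < r ->
  mean_exit_time X x r = (exit_mean (vball x r) x)%:E.
Proof.
move=> r0; have xb : x \in vball x r by rewrite mem_vball distxx.
rewrite /mean_exit_time; under eq_integral do rewrite exit_timeE.
have mF n : measurable [set o | forall k, (k <= n)%N -> gball x r (walk_pos X k o)].
  exact: (@measurable_walk [set k | (k <= n)%N] (fun k => gball x r)).
rewrite integral_nneseries//; last first.
  by move=> n; apply/measurable_EFinP; exact: measurable_indic.
rewrite -survival_series ?vball_uniq//; apply: eq_eseriesr => n _.
rewrite integral_indic// setIT -walk_law_survival ?vball_uniq//.
congr (walk_law X x _); apply/seteqP; split=> o Ao k /Ao; by rewrite mem_vball.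
Qed.

End ExitTime.

(** * The Einstein relation *)

Section Comparison.
Context {R : realType} (G : weightedGraph R) (K : R) (x : G) (r : R).
Hypotheses (K1 : 1 <= K) (hK : harnack_constant G K) (r1 : 1 <= r).
Implicit Types y z w : G.

Let B := vball x r.
Let D := vball x (2 * r).
Let g := green D x.
Let c := cap B D.
Let L := K ^+ 32.

Definition inner_bdry y := y \in B /\ exists2 w, adj y w & w \notin B.

Let xB : x \in B. Proof. by rewrite mem_vball distxx (lt_le_trans _ r1). Qed.
Let BD : {subset B <= D}. Proof. by move=> y; rewrite !mem_vball; move: r1; lra. Qed.
Let uB : uniq B := vball_uniq x r.
Let uD : uniq D := vball_uniq x (2 * r).
Let L0 : 0 < L. Proof. by rewrite exprn_gt0// (lt_le_trans _ K1). Qed.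

Lemma inner_bdryNP y : y \in B -> ~ inner_bdry y -> forall w, adj y w -> w \in B.
Proof.
by move=> yB yI w yw; apply: contrapT => /negP wB; apply: yI; split => //; exists w.
Qed.

(** All inner boundary vertices are equidistant from [x]: one has distance below [r], while another,
    having a neighbour outside [B], has distance at least [r - 1]. So [green_sphere] applies. *)
Lemma green_inner_bdry y z : inner_bdry y -> inner_bdry z -> g y <= L * g z.
Proof.
have lt a b : inner_bdry a -> inner_bdry b -> (dist x a <= dist x b)%N.
  move=> [aB _] [_ [w bw wB]]; rewrite !mem_vball -leNgt in aB wB.
  rewrite -ltnS -(ltr_nat R) (lt_le_trans aB)// (le_trans wB)// ler_nat.
  by rewrite (leq_trans (dist_triangle x b w))// -addn1 leq_add2l dist_adj.
move=> yI zI; apply: (green_sphere K1 hK uD (m := dist x z)) => // [w xw|].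
  rewrite mem_vball; case: zI => [zB _]; rewrite mem_vball in zB.
  rewrite (@lt_trans _ _ (2 * dist x z)%:R) ?ltr_nat// natrM.
  by rewrite ltr_pM2l.
by apply/eqP; rewrite eqn_leq !lt.
Qed.

Lemma charge_inner_bdry y : y \in B -> ~ inner_bdry y -> equil_charge B D y = 0.
Proof. by move=> yB yI; apply: equil_charge_eq0 => //; exact: inner_bdryNP. Qed.

Lemma green_cap_ge z : inner_bdry z -> 1 <= L * g z * c.
Proof.
move=> zI; rewrite -[leLHS](equil_charge_green BD uB uD xB) mulrC mulr_suml.
rewrite big_seq [leRHS]big_seq ler_sum// => y yB.
have [yI|/(charge_inner_bdry yB)->] := pselect (inner_bdry y); last by rewrite !mul0r.
by rewrite ler_wpM2l ?equil_charge_ge0// green_inner_bdry.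
Qed.

Lemma green_cap_le z : inner_bdry z -> g z * c <= L.
Proof.
move=> zI; rewrite -[leRHS]mulr1 -(equil_charge_green BD uB uD xB) mulrC.
rewrite mulr_suml mulr_sumr.
rewrite big_seq [leRHS]big_seq ler_sum// => y yB.
have [yI|/(charge_inner_bdry yB)->] := pselect (inner_bdry y).
  by rewrite mulrCA ler_wpM2l ?equil_charge_ge0// green_inner_bdry.
by rewrite !mul0r mulr0.
Qed.

(** Otherwise the charge would vanish, whereas the Green function integrates to 1 against it. *)
Lemma exists_inner_bdry : exists z, inner_bdry z.
Proof.
apply: contrapT => /forallNP noI; have := equil_charge_green BD uB uD xB.
rewrite big1_seq => [/esym/eqP|y /andP[_ yB]]; first by rewrite oner_eq0.
by rewrite charge_inner_bdry ?mul0r.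
Qed.

Lemma cap_gt0 : 0 < c.
Proof.
have [z /green_cap_ge h] := exists_inner_bdry.
have Lg0 : 0 <= L * g z by apply: mulr_ge0; [exact: ltW|exact: green_ge0].
rewrite ltNge; apply/negP => c0.
by have := le_trans h (mulr_ge0_le0 Lg0 c0); rewrite ler10.
Qed.

Lemma exit_mean_lower : c^-1 * vol x r <= L * exit_mean D x.
Proof.
have glow y : y \in B -> c^-1 <= L * g y.
  have lowI z : inner_bdry z -> c^-1 / L <= g z.
    move=> zI; rewrite ler_pdivrMr// -div1r ler_pdivrMr ?cap_gt0//.
    by rewrite [g z * L]mulrC green_cap_ge.
  move=> yB; rewrite mulrC -ler_pdivrMr//.
  have [/lowI//|yI] := pselect (inner_bdry y).
  (* The pole [x] may lie in this set, as superharmonicity is all that is required. *)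
  apply: (@min_principle _ _ [seq z <- B | `[< ~ inner_bdry z >]]) => [z|z w|].
  - by rewrite mem_filter => /andP[_ /BD]; exact: lap_green_ge0.
  - rewrite !mem_filter => /andP[/asboolP zI zB] zw.
    rewrite (inner_bdryNP zB zI zw) andbT => /asboolP/contrapT; exact: lowI.
  - by rewrite mem_filter yB andbT; apply/asboolP.
rewrite -(exit_mean_green uD) ?BD// volE !mulr_sumr.
apply: (@le_trans _ _ (\sum_(y <- B) L * (mu y * g y))).
  rewrite big_seq [leRHS]big_seq ler_sum// => y yB.
  by rewrite mulrCA mulrC ler_pM2l ?mu_gt0// glow.
apply: sum_subset => // y _ _; rewrite mulr_ge0 ?(ltW L0)//.
by rewrite mulr_ge0 ?green_ge0// ltW// mu_gt0.
Qed.

Lemma exit_mean_upper :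
  exit_mean D x <= exit_mean B x + L * c^-1 * vol x (2 * r).
Proof.
rewrite volE; apply: exit_mean_split => //.
  by rewrite divr_ge0 ?ltW// cap_gt0.
(* Off [B] the Green function is harmonic; neighbours of [D] minus [B] lying in [B] belong to the
   inner boundary, and outside [D] the function is 0. *)
move=> y yD yB; apply: (@max_principle _ _ [seq z <- D | z \notin B]).
- move=> z; rewrite mem_filter => /andP[zB zD]; rewrite lap_green_neq//.
  by apply: contraNneq zB => ->.
- move=> z w; rewrite !mem_filter negb_and negbK => /andP[zB _] zw.
  have [wB _|wB /= wD] := boolP (w \in B).
    rewrite ler_pdivlMr ?cap_gt0// green_cap_le//; split=> //.
    by exists z; rewrite // adj_sym.
  by rewrite green_out// divr_ge0 ?ltW// cap_gt0.
- by rewrite mem_filter yB.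
Qed.

(** For [y] in [B] the ball of radius [r] around [y] lies in [D], so the comparison bounds
    [exit_mean D y] below; integrating against the charge, of mass [c], gives the claim. *)
Lemma exit_mean_inner (C0 : R) : 0 < C0 ->
  (forall y, y \in B -> exit_mean B x <= C0 * exit_mean (vball y r) y) ->
  exit_mean B x <= C0 * c^-1 * vol x (2 * r).
Proof.
move=> C00 tc; rewrite -mulrA mulrCA mulrC ler_pdivlMr ?cap_gt0//.
apply: (@le_trans _ _
  (C0 * \sum_(y <- B) equil_charge B D y * exit_mean D y)); last first.
  by rewrite ler_pM2l// volE; exact: equil_charge_exit_mean.
rewrite mulrC mulr_suml mulr_sumr big_seq [leRHS]big_seq ler_sum// => y yB.
rewrite mulrCA ler_wpM2l ?equil_charge_ge0// (le_trans (tc _ yB))// ler_pM2l//.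
apply: exit_mean_le => z; rewrite !mem_vball => yz; rewrite mem_vball in yB.
by have := dist_triangle x y z; rewrite -(ler_nat R) natrD; lra.
Qed.

Lemma rhoE : rho x r (2 * r) = (c^-1)%:E.
Proof.
have bE (s : R) : gball x s = [set` vball x s].
  by apply/seteqP; split=> y /=; rewrite mem_vball.
by rewrite /rho !bE resistanceE// cap_gt0.
Qed.

End Comparison.

Theorem theorem5p1 (R : realType) (G : weightedGraph R)
    (d : measure_display) (Omega : measurableType d) (X : randomWalk G Omega)
    (hp0 : cond_p0 G) (hVD : volume_doubling G) (hH : elliptic_harnack G)
    (hwTC : weak_time_comparison X) :
  exists C : R, 1 < C /\
    forall (x : G) (r : R), 1 <= r ->
      (C^-1%:E * (rho x r (2 * r) * (vol_annulus x r (2 * r))%:E)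
         <= mean_exit_time X x (2 * r))%E /\
      (mean_exit_time X x (2 * r)
         <= C%:E * (rho x r (2 * r) * (vol_annulus x r (2 * r))%:E))%E.
Proof.
have [K K1 hK] := harnack_constant_exists hp0 hH.
have [DV [DV0 VD]] := hVD; have [C0 [C00 wTC]] := hwTC.
pose L := K ^+ 32; have L0 : 0 < L by rewrite exprn_gt0// (lt_le_trans _ K1).
(* The first term ensures that [C] exceeds 1, the second serves the lower bound and the third the
   upper bound. *)
pose C := 1 + DV * L + (C0 + L) * DV ^+ 4.
have C1 : 0 < DV * L by rewrite mulr_gt0.
have C2 : 0 < (C0 + L) * DV ^+ 4 by rewrite mulr_gt0 ?exprn_gt0// addr_gt0.
exists C; split=> [|x r r1]; first by rewrite /C; lra.
have r0 : 0 < r by lra.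
rewrite (rhoE x K1 hK r1) mean_exit_timeE; last by lra.
rewrite -!EFinM !lee_fin.
set rh := (cap _ _)^-1; set v := vol_annulus _ _ _; set E := exit_mean _ _.
have rh0 : 0 < rh by rewrite invr_gt0 (cap_gt0 x K1 hK r1).
have E0 : 0 <= E by exact: exit_mean_ge0.
have lower := exit_mean_lower x K1 hK r1.
have upper := exit_mean_upper x K1 hK r1.
have inner : exit_mean (vball x r) x <= C0 * rh * vol x (2 * r).
  apply: (exit_mean_inner K1 hK r1 C00) => y; rewrite mem_vball => xy.
  by have := wTC x r r0 y xy; rewrite !mean_exit_timeE// -EFinM lee_fin.
have vle := vol_annulus_compare x DV0 VD r1.
have v0 : 0 <= v.
  have V0 : 0 < vol x (2 * r) by apply: vol_gt0; lra.
  by have := lt_le_trans V0 vle; rewrite pmulr_rgt0 ?exprn_gt0//; exact: ltW.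
split.
  rewrite mulrC ler_pdivrMr; last by rewrite /C; lra.
  have h1 : v <= DV * vol x r.
    apply: le_trans (VD x r r0); rewrite /v /vol_annulus gerBl.
    exact/ltW/vol_gt0.
  apply: (@le_trans _ _ (DV * (rh * vol x r))).
    by rewrite mulrCA ler_pM2l.
  apply: (@le_trans _ _ (DV * (L * E))); first by rewrite ler_pM2l.
  rewrite mulrA mulrC ler_wpM2l// /C; lra.
rewrite -/v in vle.
have h2 : E <= (C0 + L) * (rh * vol x (2 * r)).
  apply: le_trans upper _; rewrite -/rh -/L; move: inner; lra.
apply: (le_trans h2); apply: (@le_trans _ _ ((C0 + L) * (rh * (DV ^+ 4 * v)))).
  by rewrite ler_pM2l ?addr_gt0// ler_pM2l.
rewrite (_ : _ * _ = (C0 + L) * DV ^+ 4 * (rh * v)); last by ring.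
by rewrite ler_wpM2r ?mulr_ge0 ?(ltW rh0)// /C; lra.
Qed.
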